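(* Let $p>1$, $\beta>0$, $\lambda>0$ and let $\rho$ be a probability density on $\mathbb{R}$ for which the $(p,\beta,\lambda)$-Fisher--Rényi complexity $C_{p,\beta,\lambda}[\rho]$ exists. For any $x_0\in\mathbb{R}$ and any $\sigma>0$, let $\widetilde{\rho}(x)=\frac{1}{\sigma}\,\rho\!\left(\frac{x-x_0}{\sigma}\right)$. Then $C_{p,\beta,\lambda}[\widetilde{\rho}]=C_{p,\beta,\lambda}[\rho]$.
   Context: For $\lambda>0$, the Rényi entropy power of a probability density $\rho$ on $\mathbb{R}$ is $N_\lambda[\rho]=\exp(2H_\lambda[\rho])$, where $H_\lambda[\rho]=\frac{1}{1-\lambda}\log\int_{\mathbb{R}}[\rho(x)]^\lambda\,dx$ for $\lambda\neq 1$, and for $\lambda=1$ (limiting case) $H_1[\rho]=-\int_{\mathbb{R}}\rho(x)\log\rho(x)\,dx$. For $p\in(1,\infty)$ and $\beta>0$, the $(p,\beta)$-Fisher information of a continuously differentiable density $\rho$ is $$F_{p,\beta}[\rho]=\left(\int_{\mathbb{R}}\left|[\rho(x)]^{\beta-1}\,\frac{d}{dx}\log\rho(x)\right|^p\rho(x)\,dx\right)^{\frac{2}{p\beta}},$$ provided the integral exists; when $\rho$ is strictly positive only on a bounded support, the integral is over this support (and $\rho$ is required to be differentiable on the closure of the support). The $(p,\beta,\lambda)$-Fisher--Rényi complexity of $\rho$ is $C_{p,\beta,\lambda}[\rho]=\big(F_{p,\beta}[\rho]\,N_\lambda[\rho]\big)^\beta$, provided the involved quantities exist. *)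

(* Defs.v *)
From mathcomp Require Import all_boot all_order all_algebra.
From mathcomp Require Import all_classical all_reals all_analysis.

Set Implicit Arguments.
Unset Strict Implicit.
Unset Printing Implicit Defensive.

Import Order.TTheory GRing.Theory Num.Theory.
Import numFieldNormedType.Exports.

Local Open Scope classical_set_scope.
Local Open Scope ring_scope.

Section fisher_renyi.
Context {R : realType}.
Implicit Types (rho f : R -> R) (K : set R) (x p beta lambda : R).

Definition is_density rho : Prop :=
  [/\ measurable_fun [set: R] rho, forall x, 0 <= rho x &
      (\int[lebesgue_measure]_x (rho x)%:E = 1)%E].

Definition posset rho : set R := [set x | 0 < rho x].

(* Derivative relative to K: the difference quotient is only taken at points
   of K, so that it is one-sided at an endpoint of an interval K. As usual, it
   is only meaningful at accumulation points of K. *)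
Definition derivable_in K f x : Prop :=
  limit_point K x /\
  cvg (h^-1 * (f (h + x) - f x) @[h --> within [set h | K (h + x)] 0^']).

Definition derive_in K f x : R :=
  lim (h^-1 * (f (h + x) - f x) @[h --> within [set h | K (h + x)] 0^']).

Definition C1 rho : Prop :=
  (forall x, derivable rho x 1) /\ continuous rho^`()%classic.

(* Densities that are positive only on a bounded set need not be smooth across
   the boundary of that set (think of the uniform density on a segment). *)
Definition C1_bounded_support rho : Prop :=
  [/\ bounded_set (posset rho),
      forall x, closure (posset rho) x ->
        derivable_in (closure (posset rho)) rho x &
      {within posset rho,
        continuous (derive_in (closure (posset rho)) rho)}].

(* ln rho is only meaningful on posset rho, whence the relative derivative.
   When posset rho is open (in particular when rho is C1) it is the ordinary
   derivative there, see derive_in_open. *)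
Definition fisher_integrand p beta rho x : R :=
  `|rho x `^ (beta - 1) * derive_in (posset rho) (fun y => ln (rho y)) x| `^ p
    * rho x.

Definition fisher_exists p beta rho : Prop :=
  (C1 rho \/ C1_bounded_support rho) /\
  lebesgue_measure.-integrable (posset rho)
    (fun x => (fisher_integrand p beta rho x)%:E).

Definition fisher p beta rho : R :=
  (\int[lebesgue_measure]_(x in posset rho) fisher_integrand p beta rho x)
    `^ (2 / (p * beta)).

(* For lambda = 1, the library's value ln 0 = 0 gives the convention
   0 log 0 = 0; for lambda > 0, 0 `^ lambda = 0. *)
Definition renyi_entropy lambda rho : R :=
  if lambda == 1 then
    - \int[lebesgue_measure]_(x in [set: R]) (rho x * ln (rho x))
  else
    (1 - lambda)^-1 *
      ln (\int[lebesgue_measure]_(x in [set: R]) (rho x `^ lambda)).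

(* If lambda != 1 and rho is a density, the integral is automatically nonzero,
   so finiteness is the only condition. *)
Definition renyi_exists lambda rho : Prop :=
  lebesgue_measure.-integrable [set: R]
    (fun x => (if lambda == 1 then rho x * ln (rho x)
               else rho x `^ lambda)%:E).

Definition renyi_power lambda rho : R := expR (2 * renyi_entropy lambda rho).

Definition FR_complexity p beta lambda rho : R :=
  (fisher p beta rho * renyi_power lambda rho) `^ beta.

Definition FR_complexity_exists p beta lambda rho : Prop :=
  fisher_exists p beta rho /\ renyi_exists lambda rho.

Lemma derive_in_open K f x : open K -> K x -> derive_in K f x = f^`()%classic x.
Proof.
move=> oK Kx; rewrite /derive_in /derive1.
suff -> : within [set h | K (h + x)] 0^' = 0^' by [].
have KE : \forall h \near (0 : R), K (h + x).
  have : \forall y \near x, K y by exact: open_nbhs_nbhs.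
  by rewrite (near_shift 0) subr0.
rewrite eqEsubset; split => A; rewrite /within /dnbhs /within /= => HA.
- by apply: filterS2 KE HA => h Kh hA h0; exact: hA h0 Kh.
- by apply: filterS HA => h hA h0 _; exact: hA.
Qed.

End fisher_renyi.

(* Main.v *)
Require Import Defs.
From mathcomp Require Import all_boot all_order all_algebra.
From mathcomp Require Import all_classical all_reals all_analysis.
From mathcomp Require Import measurable_realfun ring lra.
Import Order.TTheory GRing.Theory Num.Theory.
Import numFieldNormedType.Exports.
Local Open Scope classical_set_scope.
Local Open Scope ring_scope.

(** With [a x = (x - x0) / s] and [rhot = s^-1 * (rho \o a)], the measure
    [mu (a @^-1` D)] equals [s * mu D], so integrals of functions of [a x] pick
    up a factor [s]. Derivatives pick up a factor [s^-1], hence the Fisher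
    information is multiplied by [s^-2], while the Renyi entropy is shifted by
    [ln s] and its power is multiplied by [s ^ 2]: the two factors cancel. *)

(** * Lebesgue measure and integrals under an affine change of variables *)

Section affine_change_of_variables.
Context {R : realType}.
Implicit Types (D : set R).
Local Notation mu := (@lebesgue_measure R).
Local Notation aff x0 s := (fun x : R => (x - x0) / s).

Lemma measurable_aff (x0 s : R) : measurable_fun [set: R] (aff x0 s).
Proof. by apply: measurable_funM => //; apply: measurable_funB. Qed.

(** By uniqueness of Lebesgue measure: the pushforward of [mu] along the affine map, scaled by
    [s^-1], gives each half-open interval its length. *)
Lemma lebesgue_measure_aff (x0 s : R) D : 0 < s -> measurable D ->
  mu (aff x0 s @^-1` D) = (s%:E * mu D)%E.
Proof.
move=> s0 mD.
have sV0 : 0 <= s^-1 by rewrite invr_ge0 ltW.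
have ma : measurable_fun setT (aff x0 s : _ -> measurableTypeR R).
  exact: measurable_aff.
pose m := mscale (NngNum sV0)
  (pushforward mu (aff x0 s : _ -> measurableTypeR R)).
suff -> : mu D = m ma D.
  by rewrite /m /mscale /= muleA -EFinM mulfV ?gt_eqF// mul1e.
apply: (@lebesgue_measure_unique R (m ma)) mD => X [[u v] /= _ <-].
rewrite /m /mscale /= /pushforward.
have -> : aff x0 s @^-1` `]u, v] = `]u * s + x0, v * s + x0]%classic.
  apply/seteqP; split => x /=; rewrite !in_itv/= ltr_pdivlMr// ler_pdivrMr//.
    by move=> /andP[? ?]; apply/andP; split; lra.
  by move=> /andP[? ?]; apply/andP; split; lra.
rewrite !lebesgue_measure_itv/= !lte_fin.
have -> : (u * s + x0 < v * s + x0) = (u < v) by rewrite ltrD2r ltr_pM2r.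
case: ifPn => _; last by rewrite mule0.
by rewrite -!EFinD -EFinM; congr EFin; field; rewrite gt_eqF.
Qed.

Lemma measurable_preimage_aff (x0 s : R) D : measurable D ->
  measurable (aff x0 s @^-1` D).
Proof.
by move=> mD; rewrite -[X in measurable X]setTI; exact: measurable_aff.
Qed.

Lemma measurable_fun_comp_aff (x0 s : R) D d (Y : measurableType d) (f : R -> Y) :
  measurable D -> measurable_fun D f ->
  measurable_fun (aff x0 s @^-1` D) (f \o aff x0 s).
Proof.
move=> mD mf; apply: (measurable_comp mD) => //.
  by move=> _ [x Dx <-].
exact: measurable_funTS (measurable_aff _ _).
Qed.

(** The pushforward of [mu] along the affine map is [s] times [mu], so both sides are the integral
    of [f] over [D] against the same measure. *)
Lemma ge0_integral_aff (x0 s : R) D (f : R -> \bar R) : 0 < s -> measurable D ->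
  measurable_fun D f -> (forall x, D x -> 0 <= f x)%E ->
  (\int[mu]_(x in aff x0 s @^-1` D) f (((x - x0) / s)%R) =
   s%:E * \int[mu]_(x in D) f x)%E.
Proof.
move=> s0 mD mf f0.
have s0' : 0 <= s := ltW s0.
rewrite -[s in RHS]/((NngNum s0')%:num).
rewrite -(@ge0_integral_mscale _ (measurableTypeR R) R mu D mD (NngNum s0') f)//.
have ma : measurable_fun setT (aff x0 s : measurableTypeR R -> measurableTypeR R).
  exact: measurable_aff.
have /= <- := @ge0_integral_pushforward _ _ _ _ R _ ma mu D f mD mf.
- apply: eq_measure_integral => A mA _.
  exact: lebesgue_measure_aff.
- by move=> y /set_mem; exact: f0.
Qed.

Lemma integrable_aff (x0 s : R) D (f : R -> R) : 0 < s -> measurable D ->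
  mu.-integrable D (EFin \o f) ->
  mu.-integrable (aff x0 s @^-1` D) (EFin \o (fun x => f ((x - x0) / s))).
Proof.
move=> s0 mD /integrableP[mf foo]; apply/integrableP; split.
  exact: (measurable_fun_comp_aff x0 s D _ _ _ mD mf).
rewrite (ge0_integral_aff x0 s D (fun x => `|(f x)%:E|%E))//.
- by rewrite lte_mul_pinfty // lee_fin ltW.
- exact: measurableT_comp.
Qed.

Lemma Rintegral_aff (x0 s : R) D (f : R -> R) : 0 < s -> measurable D ->
  mu.-integrable D (EFin \o f) ->
  \int[mu]_(x in aff x0 s @^-1` D) f ((x - x0) / s) =
  s * \int[mu]_(x in D) f x.
Proof.
move=> s0 mD fi; rewrite /Rintegral.
suff -> : (\int[mu]_(x in aff x0 s @^-1` D) (f ((x - x0) / s)%R)%:E =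
   s%:E * \int[mu]_(x in D) (f x)%:E)%E.
  by rewrite fineM//; exact: integrable_fin_num.
have mf : measurable_fun D (EFin \o f) := measurable_int _ fi.
(* Distributing [s] over the difference of the two parts requires excluding [oo - oo]; the integral
   of the positive part is finite. *)
rewrite integralE [in RHS]integralE muleBr//; last first.
  rewrite fin_num_adde_defr//.
  exact/integrable_fin_num/integrable_funepos.
congr (_ - _)%E.
- rewrite -(ge0_integral_aff x0 s D (EFin \o f)^\+%E)//.
  by apply: eq_integral => x _; rewrite !funeposE.
  exact: measurable_funepos.
- rewrite -(ge0_integral_aff x0 s D (EFin \o f)^\-%E)//.
  by apply: eq_integral => x _; rewrite !funenegE.
  exact: measurable_funeneg.
Qed.

End affine_change_of_variables.

(** * Relative derivatives, limit points and closures under an affine map *)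

Section derive_in.
Context {R : realType}.
Local Notation aff x0 s := (fun x : R => (x - x0) / s).

Lemma continuous_aff (x0 s : R) : continuous (aff x0 s).
Proof.
move=> x; apply: (@continuous_comp _ _ _ (fun y => y - x0) (fun y => y / s)).
  by apply: cvgB; [exact: cvg_id | exact: cvg_cst].
exact: mulrr_continuous.
Qed.

Lemma dnbhs0_scale (s : R) (P : set R) : s != 0 -> dnbhs (0 : R) P ->
  dnbhs (0 : R) [set h | P (h / s)].
Proof.
move=> s0 HP.
have cs : (h / s) @[h --> (0 : R)] --> (0 : R).
  by have := @mulrr_continuous R s^-1 0; rewrite /continuous_at mul0r.
have HQ : nbhs (0 : R) (fun h => h / s != 0 -> P (h / s)) := cs _ HP.
change (nbhs (0 : R) (fun h : R => h != 0 -> P (h / s))).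
apply: filterS HQ => h + h0.
by apply; rewrite mulf_neq0// invr_eq0.
Qed.

(** The two inclusions come from [dnbhs0_scale] at [s^-1] and at [s]. Equality of the filters lets
    convergence pass in both directions. *)
Lemma within_dnbhs0_aff (x0 s x : R) (K : set R) : s != 0 ->
  (h / s) @[h --> within [set h | (aff x0 s @^-1` K) (h + x)] 0^'] =
  within [set h | K (h + (x - x0) / s)] 0^'.
Proof.
move=> s0; apply/seteqP; split=> A; rewrite /within /=.
  have sV0 : s^-1 != 0 by rewrite invr_eq0.
  move=> /(@dnbhs0_scale _ _ sV0) /=; apply: filterS => h /=.
  have -> : (h / s^-1 + x - x0) / s = h + (x - x0) / s by field.
  by rewrite invrK mulfK.
move=> /(@dnbhs0_scale _ _ s0) /=; apply: filterS => h /=.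
by have -> : (h + x - x0) / s = h / s + (x - x0) / s by field.
Qed.

Lemma limit_point_aff (x0 s x : R) (K : set R) : s != 0 ->
  limit_point K ((x - x0) / s) -> limit_point (aff x0 s @^-1` K) x.
Proof.
move=> s0 lK U Ux.
have cu : {for (x - x0) / s, continuous (fun y : R => y * s + x0)}.
  by apply: cvgD; [exact: mulrr_continuous | exact: cvg_cst].
have [|y [yx Ky Uy]] := lK ((fun y : R => y * s + x0) @^-1` U).
  by apply: cu; rewrite divfK// subrK.
exists (y * s + x0); split => //.
  apply: contra_neq yx => <-; by field.
by rewrite /= addrK mulfK.
Qed.

(** A point [y != x] of the closure inside the interior of [U] has a neighbourhood within [U] that
    avoids [x], and this neighbourhood meets [K]. *)
Lemma limit_point_closureI (x : R) (K : set R) :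
  limit_point (closure K) x -> limit_point K x.
Proof.
move=> lK U Ux.
have [y [yx clKy Uy]] := lK _ (nbhs_interior Ux).
have : nbhs y (U `&` [set~ x]).
  apply: filterI => //; apply: open_nbhs_nbhs; split; last exact/eqP.
  exact/closed_openC/closed_eq.
by move=> /clKy[z [Kz [Uz zx]]]; exists z; split => //; exact/eqP.
Qed.

Lemma limit_point_open (x : R) (K : set R) : open K -> K x -> limit_point K x.
Proof.
move=> oK Kx U Ux.
have : dnbhs x (K `&` U).
  by apply: nbhs_dnbhs; apply: filterI => //; exact: open_nbhs_nbhs.
rewrite /dnbhs /within /= => KU.
have [y [yx [Ky Uy]]] := @filter_ex _ (dnbhs x) _ _ (filterI (nbhs_dnbhs_neq x) KU).
by exists y.
Qed.

(** Properness makes limits unique, which is what allows computing with [lim] in [derive_in].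
    Translating by [x] turns points of [K] near [x] into admissible increments. *)
Lemma within_dnbhs0_proper (x : R) (K : set R) : limit_point K x ->
  ProperFilter (within [set h | K (h + x)] (dnbhs (0 : R))).
Proof.
move=> lK; apply: Build_ProperFilter_ex => P; rewrite /within /= => HP.
have [|y [yx Ky Py]] := lK ((fun y : R => y - x) @^-1`
  [set h | h != 0 -> K (h + x) -> P h]).
  have : (y - x) @[y --> x] --> (0 : R).
    by rewrite -(subrr x); apply: cvgB; [exact: cvg_id | exact: cvg_cst].
  by apply.
exists (y - x); apply: Py; first by rewrite subr_eq0.
by rewrite subrK.
Qed.

Section affine_rescaling.
Context (c k x0 s x : R) (K : set R) (f g : R -> R).
Context (s_neq0 : s != 0) (Kx : K ((x - x0) / s)).
Context (gE : forall y, K ((y - x0) / s) -> g y = c + k * f ((y - x0) / s)).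

Let x' := (x - x0) / s.

(** The constant [c] cancels in the difference. The shape [c + k * f] covers both the rescaled
    density ([c = 0], [k = s^-1]) and its logarithm ([c = ln s^-1], [k = 1]). *)
Let quotient_aff :
  h^-1 * (g (h + x) - g x) @[h --> within [set h | (aff x0 s @^-1` K) (h + x)] 0^'] =
  k / s * (h^-1 * (f (h + x') - f x')) @[h --> within [set h | K (h + x')] 0^'].
Proof.
rewrite -within_dnbhs0_aff//.
have qE h : K ((h + x - x0) / s) -> h^-1 * (g (h + x) - g x) =
    k / s * ((h / s)^-1 * (f (h / s + x') - f x')).
  move=> Kh; rewrite !gE// invf_div.
  have -> : (h + x - x0) / s = h / s + x' by rewrite /x'; field.
  (* Abstracting [h^-1] spares [field] the side condition [h != 0], since [qE] is also stated at
     [h = 0]. *)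
  by move: h^-1 => hV; field.
by apply/seteqP; split=> A; apply: (@filterS _ (dnbhs (0 : R)) _) => h /= + Kh;
  move=> /(_ Kh); rewrite qE.
Qed.

Lemma derivable_in_aff :
  derivable_in K f x' -> derivable_in (aff x0 s @^-1` K) g x.
Proof.
move=> [lK cf]; split; first exact: limit_point_aff.
rewrite quotient_aff; have FF := within_dnbhs0_proper _ _ lK.
exact: is_cvgMl_tmp.
Qed.

(** As [k / s] is nonzero, the two quotients converge or diverge together; the formula thus applies
    to [ln (rho y)] without a chain rule. *)
Lemma derive_in_aff : k != 0 -> limit_point K x' ->
  derive_in (aff x0 s @^-1` K) g x = k / s * derive_in K f x'.
Proof.
move=> k0 lK; rewrite /derive_in quotient_aff.
have FF := within_dnbhs0_proper _ _ lK.
have ks0 : k / s != 0 by rewrite mulf_neq0// invr_eq0.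
have [cf|dvgf] := pselect (cvg (h^-1 * (f (h + x') - f x')
  @[h --> within [set h | K (h + x')] 0^'])).
  by apply/cvg_lim => //; apply: cvgMl_tmp.
(* Without convergence both limits are the default value [point = 0]. *)
rewrite (dvgP dvgf) dvgP ?[point]/0 ?mulr0//.
by rewrite is_cvgMlE_tmp.
Qed.

End affine_rescaling.

(** One inclusion is continuity; the other is the same inclusion for the inverse map, which is again
    of the form [aff], with parameters [- x0 / s] and [s^-1]. *)
Lemma closure_aff (x0 s : R) (K : set R) : s != 0 ->
  closure (aff x0 s @^-1` K) = aff x0 s @^-1` closure K.
Proof.
have sub (a b : R) (A : set R) :
    closure (aff a b @^-1` A) `<=` aff a b @^-1` closure A.
  move=> x clx B Bx.
  have [y [Ay By]] := clx _ (@continuous_aff a b x _ Bx).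
  by exists (aff a b y).
move=> s0; apply/seteqP; split; first exact: sub.
move=> x /= clx.
have := sub (- x0 / s) s^-1 (aff x0 s @^-1` K) ((x - x0) / s).
rewrite /preimage /= => /(_ _).
have -> : ((x - x0) / s - - x0 / s) / s^-1 = x by field.
apply; rewrite [X in closure X](_ : _ = K)//.
apply/seteqP; split => y /=;
  by have -> : ((y - - x0 / s) / s^-1 - x0) / s = y by field.
Qed.

Lemma within_continuous_aff (x0 s : R) (K : set R) (f : R -> R) :
  {within K, continuous f} -> {within aff x0 s @^-1` K, continuous (f \o aff x0 s)}.
Proof.
move=> /subspace_continuousP cf; apply/subspace_continuousP => x Kx.
apply: cvg_comp (cf _ Kx) => A; rewrite /within /= => KA.
exact: (@continuous_aff x0 s x _ KA).
Qed.

End derive_in.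

(** * Stability of the regularity conditions under rescaling *)

Section densities.
Context {R : realType}.
Implicit Types (rho : R -> R).
Local Notation mu := (@lebesgue_measure R).
Local Notation aff x0 s := (fun x : R => (x - x0) / s).
Local Notation rescale x0 s rho := (fun x : R => s^-1 * rho ((x - x0) / s)).

Lemma posset_rescale (x0 s : R) rho : 0 < s ->
  posset (rescale x0 s rho) = aff x0 s @^-1` posset rho.
Proof.
move=> s0; apply/seteqP; split => x; by rewrite /posset /= pmulr_rgt0// invr_gt0.
Qed.

Lemma measurable_posset rho : measurable_fun [set: R] rho -> measurable (posset rho).
Proof.
move=> mrho; rewrite -[posset rho]setTI.
rewrite (_ : posset rho = rho @^-1` `]0, +oo[%classic).
  by apply: mrho => //; exact: measurable_itv.
by apply/seteqP; split => x; rewrite /posset /= in_itv/= andbT.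
Qed.

Lemma C1_rescale (x0 s : R) rho : C1 rho -> C1 (rescale x0 s rho).
Proof.
move=> [drho crho].
have d (x : R) : is_derive x 1 (rescale x0 s rho)
    (s^-1 * (rho^`()%classic ((x - x0) / s) * s^-1)).
  have da : is_derive x 1 (aff x0 s) s^-1.
    by apply: is_derive_eq; rewrite scaler0 add0r subr0 [LHS]mulr1.
  have dr : is_derive ((x - x0) / s) 1 rho (rho^`()%classic ((x - x0) / s)).
    by rewrite derive1E; exact/derivableP.
  have dc := @is_derive1_comp R rho (aff x0 s) x _ _ dr da.
  exact: is_deriveZ.
split => [x|]; first by have [] := d x.
rewrite (_ : _^`()%classic =
    (fun x => s^-1 * (rho^`()%classic ((x - x0) / s) * s^-1))); last first.
  by apply/funext => x; rewrite derive1E; apply: derive_val.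
move=> x; apply: cvgMl_tmp; apply: cvgMr_tmp.
by apply: (continuous_comp (@continuous_aff R x0 s x)); exact: crho.
Qed.

Lemma open_posset rho : continuous rho -> open (posset rho).
Proof.
move=> crho.
rewrite (_ : posset rho = rho @^-1` [set x | 0 < x])//.
by apply: open_comp => // x _; exact: crho.
Qed.

Lemma C1_continuous rho : C1 rho -> continuous rho.
Proof. by move=> [drho _] x; apply/differentiable_continuous/derivable1_diffP. Qed.

(* At an isolated point of [posset rho] the filter defining [derive_in] would be
   improper and its limit an arbitrary value, with no scaling behaviour. *)
Lemma limit_point_posset rho x : C1 rho \/ C1_bounded_support rho ->
  posset rho x -> limit_point (posset rho) x.
Proof.
move=> [C1rho|[_ drho _]] rhox.
  by apply: limit_point_open => //; exact/open_posset/C1_continuous.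
by apply: limit_point_closureI; have [] := drho _ (subset_closure rhox).
Qed.

Lemma bounded_set_aff (x0 s : R) (A : set R) : s != 0 ->
  bounded_set A -> bounded_set (aff x0 s @^-1` A).
Proof.
move=> s0 [M [Mr AM]].
(* The [+ 1] is there because [AM] only provides bounds strictly above [M]. *)
exists (`|x0| + `|s| * (`|M| + 1)); split; first exact: num_real.
move=> N MN x Ax /=; apply/ltW/(le_lt_trans _ MN).
have -> : x = x0 + s * ((x - x0) / s) by field.
rewrite (le_trans (ler_normD _ _))// lerD2l normrM ler_wpM2l//.
by apply: (AM (`|M| + 1)) => //; rewrite (le_lt_trans (ler_norm _))// ltrDl.
Qed.

Lemma C1_bounded_support_rescale (x0 s : R) rho : 0 < s ->
  C1_bounded_support rho -> C1_bounded_support (rescale x0 s rho).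
Proof.
move=> s0 [brho drho crho].
have s0' : s != 0 by rewrite gt_eqF.
have sV0 : s^-1 != 0 by rewrite invr_eq0.
split; rewrite posset_rescale//.
- exact: bounded_set_aff.
- move=> x; rewrite closure_aff// => clx.
  by apply: (derivable_in_aff 0 s^-1 _ _ _ _ rho) (drho _ clx) => // y _;
    rewrite add0r.
rewrite closure_aff//.
have := @within_continuous_aff R x0 s _ _ crho.
(* One factor [s^-1] comes from the prefactor of the density, the other from the inner affine map.
   The resulting function agrees with the relative derivative on the positivity set. *)
move=> /(within_continuous_comp _ _ (fun y => s^-1 / s * y)) cc.
apply: subspace_eq_continuous (cc _) => [x /set_mem rhox|]; last first.
  by move=> y _; exact: mulrl_continuous.
have clx := @subset_closure _ (posset rho) _ rhox.
have [lx _] := drho _ clx.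
apply/esym; apply: (derive_in_aff 0 s^-1 x0 s x (closure (posset rho)) rho) => //.
by move=> y _; rewrite add0r.
Qed.

End densities.

(** * Scaling of the Fisher information and of the Rényi entropy *)

Section complexity.
Context {R : realType}.
Implicit Types (rho : R -> R).
Local Notation mu := (@lebesgue_measure R).
Local Notation aff x0 s := (fun x : R => (x - x0) / s).
Local Notation rescale x0 s rho := (fun x : R => s^-1 * rho ((x - x0) / s)).

Lemma is_density_rescale (x0 s : R) rho : 0 < s ->
  is_density rho -> is_density (rescale x0 s rho).
Proof.
move=> s0 [mrho rho0 rho1]; split.
- apply: measurable_funM => //; apply: measurableT_comp => //.
  exact: measurable_aff.
- by move=> x; rewrite mulr_ge0// invr_ge0 ltW.
- under eq_integral do rewrite EFinM.
  rewrite ge0_integralZl//; last 3 first.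
  + apply/measurable_EFinP; apply: measurableT_comp => //.
    exact: measurable_aff.
  + by move=> x _; rewrite lee_fin.
  + by rewrite lee_fin invr_ge0 ltW.
  have := ge0_integral_aff x0 s setT (EFin \o rho) s0 measurableT.
  rewrite preimage_setT /= rho1 mule1 => ->.
  + by rewrite -EFinM mulVf// gt_eqF.
  + exact/measurable_EFinP.
  + by move=> x _; rewrite lee_fin.
Qed.

Lemma is_density_integrable rho :
  is_density rho -> mu.-integrable setT (EFin \o rho).
Proof.
move=> [mrho rho0 rho1]; apply/integrableP; split; first exact/measurable_EFinP.
under eq_integral do rewrite /= ger0_norm//.
by rewrite rho1 ltry.
Qed.

(** On the positivity set the prefactor only adds [ln s^-1] to the logarithm, so the log-derivative
    gains one [s^-1]. With [s^-1]^ (beta - 1)[this makes]s^-1 [^ beta] inside the [p]-th power; the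
    last [s^-1] comes from the weight. *)
Lemma fisher_integrand_rescale (p beta x0 s : R) rho (x : R) : 0 < s ->
  C1 rho \/ C1_bounded_support rho -> posset rho ((x - x0) / s) ->
  fisher_integrand p beta (rescale x0 s rho) x =
  s^-1 `^ (beta * p) * s^-1 * fisher_integrand p beta rho ((x - x0) / s).
Proof.
move=> s0 smooth rhox; rewrite /fisher_integrand posset_rescale//.
have s0' : s != 0 by rewrite gt_eqF.
have sV0 : 0 < s^-1 by rewrite invr_gt0.
rewrite (derive_in_aff (ln s^-1) 1 x0 s x (posset rho)
  (fun y => ln (rho y)))//; last 2 first.
- by move=> y rhoy; rewrite mul1r lnM// posrE.
- exact: limit_point_posset.
set d := derive_in _ _ _; set r := rho _.
have r0 : 0 < r by [].
rewrite powRM ?ltW// mulrACA.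
have -> : s^-1 `^ (beta - 1) * (1 / s) = s^-1 `^ beta.
  rewrite mul1r -[X in _ * X]powRr1 ?ltW// -powRD ?subrK//.
  by rewrite (gt_eqF sV0) implybT.
rewrite normrM (ger0_norm (powR_ge0 _ _)) powRM ?powR_ge0// -powRrM.
by rewrite mulrACA.
Qed.

Lemma fisher_exists_rescale (p beta x0 s : R) rho : 0 < s ->
  measurable_fun [set: R] rho ->
  fisher_exists p beta rho -> fisher_exists p beta (rescale x0 s rho).
Proof.
move=> s0 mrho [smooth irho]; split.
  case: smooth => ?; [left; exact: C1_rescale|right].
  exact: C1_bounded_support_rescale.
rewrite posset_rescale//.
have mD := measurable_posset _ mrho.
have mD' := measurable_preimage_aff x0 s _ mD.
have irho' := integrable_aff x0 s _ _ s0 mD irho.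
have := @integrableZl _ (measurableTypeR R) R mu _ mD'
  (s^-1 `^ (beta * p) * s^-1) _ irho'.
apply: eq_integrable => // x /set_mem rhox.
by rewrite fisher_integrand_rescale.
Qed.

Lemma fisher_rescale (p beta x0 s : R) rho : 0 < s -> p != 0 -> beta != 0 ->
  measurable_fun [set: R] rho -> fisher_exists p beta rho ->
  fisher p beta (rescale x0 s rho) = s^-1 ^+ 2 * fisher p beta rho.
Proof.
move=> s0 p0 beta0 mrho [smooth irho].
have mD := measurable_posset _ mrho.
have sV0 : 0 <= s^-1 by rewrite invr_ge0 ltW.
rewrite /fisher posset_rescale//.
set D' := _ @^-1` _.
have -> : \int[mu]_(x in D') fisher_integrand p beta (rescale x0 s rho) x =
    \int[mu]_(x in D') (s^-1 `^ (beta * p) * s^-1 *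
      fisher_integrand p beta rho ((x - x0) / s)).
  by apply: eq_Rintegral => x /set_mem rhox; rewrite fisher_integrand_rescale.
rewrite RintegralZl//; last 2 first.
- exact: measurable_preimage_aff.
- exact: integrable_aff.
(* The Jacobian [s] cancels the [s^-1] of the weight; the remaining exponent [beta * p] becomes [2]
   under the outer power. *)
rewrite Rintegral_aff// mulrA -(mulrA _ s^-1) mulVf ?gt_eqF// mulr1.
rewrite powRM ?powR_ge0//; last first.
  apply: Rintegral_ge0 => x rhox.
  by rewrite /fisher_integrand mulr_ge0 ?powR_ge0// ltW.
rewrite -powRrM; congr (_ * _).
have -> : beta * p * (2 / (p * beta)) = 2 by field; rewrite p0 beta0.
by rewrite powR_mulrn.
Qed.

(* Needed because [ln 0 = 0] would break the additivity of [ln]. *)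
Lemma Rintegral_powR_gt0 (lambda : R) rho : is_density rho ->
  mu.-integrable setT (EFin \o (fun x => rho x `^ lambda)) ->
  0 < \int[mu]_(x in setT) (rho x `^ lambda).
Proof.
move=> [mrho rho0 rho1] irho.
rewrite lt_neqAle Rintegral_ge0 ?andbT; last by move=> x _; exact: powR_ge0.
apply/negP => /eqP I0.
have J0 : (\int[mu]_x `|(rho x `^ lambda)%:E| = 0)%E.
  under eq_integral do rewrite gee0_abs ?lee_fin ?powR_ge0//.
  by rewrite -[LHS]fineK ?integrable_fin_num// -/(Rintegral _ _ _) -I0.
have /(ae_eq_integral_abs _ measurableT) ae0 := J0.
have : (\int[mu]_x (rho x)%:E = \int[mu]_x (cst 0 x))%E.
  apply: ae_eq_integral => //; first exact/measurable_EFinP.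
  have := ae0 (measurable_int _ irho); apply: filterS => x /(_ I) /= [].
  by move=> /powR_eq0_eq0 -> _.
by rewrite rho1 integral0 => /eqP; rewrite onee_eq0.
Qed.

(** Where the density vanishes both sides are [0], whatever the value of [ln 0]; elsewhere [ln] is
    additive. *)
Lemma rescale_mul_ln (x0 s : R) rho (x : R) : 0 < s -> (forall x, 0 <= rho x) ->
  rescale x0 s rho x * ln (rescale x0 s rho x) =
  s^-1 * (rho ((x - x0) / s) * ln (rho ((x - x0) / s)) -
          ln s * rho ((x - x0) / s)).
Proof.
move=> s0 rho0; rewrite /=; set r := rho _.
have [->|r_neq0] := eqVneq r 0; first by rewrite !(mulr0, mul0r) subr0 mulr0.
have r_gt0 : 0 < r by rewrite lt_neqAle eq_sym r_neq0 rho0.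
by rewrite lnM ?posrE ?invr_gt0// lnV ?posrE//; ring.
Qed.

Lemma integrable_mul_lnB (s : R) rho : is_density rho ->
  mu.-integrable setT (EFin \o (fun x => rho x * ln (rho x))) ->
  mu.-integrable setT (EFin \o (fun x => rho x * ln (rho x) - ln s * rho x)).
Proof.
move=> drho iln.
have irho := is_density_integrable _ drho.
have ic := @integrableZl _ (measurableTypeR R) R mu _ measurableT (ln s) _ irho.
have := @integrableB _ (measurableTypeR R) R mu _ measurableT _ _ iln ic.
by apply: eq_integrable => // x _.
Qed.

Lemma renyi_exists_rescale (lambda x0 s : R) rho : 0 < s -> is_density rho ->
  renyi_exists lambda rho -> renyi_exists lambda (rescale x0 s rho).
Proof.
move=> s0 drho; have [_ rho0 _] := drho.
rewrite /renyi_exists; case: (eqVneq lambda 1) => _ irho.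
  have := integrable_aff x0 s _ _ s0 measurableT
    (integrable_mul_lnB s _ drho irho).
  rewrite preimage_setT => ir'.
  have := @integrableZl _ (measurableTypeR R) R mu _ measurableT s^-1 _ ir'.
  apply: eq_integrable => // x _; rewrite /= -EFinM; congr EFin.
  exact/esym/rescale_mul_ln.
have := integrable_aff x0 s _ _ s0 measurableT irho.
rewrite preimage_setT => ir'.
have := @integrableZl _ (measurableTypeR R) R mu _ measurableT
  (s^-1 `^ lambda) _ ir'.
by apply: eq_integrable => // x _; rewrite powRM// invr_ge0 ltW.
Qed.

Lemma renyi_entropy_rescale (lambda x0 s : R) rho : 0 < s -> is_density rho ->
  renyi_exists lambda rho ->
  renyi_entropy lambda (rescale x0 s rho) = ln s + renyi_entropy lambda rho.
Proof.
move=> s0 drho; have [_ rho0 rho1] := drho.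
have s0' : s != 0 by rewrite gt_eqF.
rewrite /renyi_exists /renyi_entropy; case: (eqVneq lambda 1) => [_|lambda1] irho.
  have iln := integrable_mul_lnB s _ drho irho.
  have iaff := integrable_aff x0 s _ _ s0 measurableT iln.
  have Iaff := Rintegral_aff x0 s _ _ s0 measurableT iln.
  rewrite preimage_setT in iaff Iaff.
  have -> : \int[mu]_x (rescale x0 s rho x * ln (rescale x0 s rho x)) =
      \int[mu]_x (s^-1 * (rho ((x - x0) / s) * ln (rho ((x - x0) / s)) -
        ln s * rho ((x - x0) / s))).
    by apply: eq_Rintegral => x _; exact: rescale_mul_ln.
  rewrite RintegralZl// Iaff mulKf//.
  have irho1 := is_density_integrable _ drho.
  have ic := @integrableZl _ (measurableTypeR R) R mu _ measurableT (ln s) _ irho1.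
  rewrite RintegralB// RintegralZl//.
  (* The total mass [1] turns the correction term into exactly [ln s]. *)
  by rewrite [X in ln s * X]/Rintegral rho1 mulr1; ring.
have iaff := integrable_aff x0 s _ _ s0 measurableT irho.
have Iaff := Rintegral_aff x0 s _ _ s0 measurableT irho.
rewrite preimage_setT in iaff Iaff.
have I0 := Rintegral_powR_gt0 _ _ drho irho.
under eq_Rintegral do rewrite powRM ?invr_ge0 ?(ltW s0)//.
rewrite RintegralZl// Iaff !lnM ?posrE ?powR_gt0 ?mulr_gt0 ?invr_gt0//.
rewrite ln_powR lnV ?posrE//; field.
by rewrite subr_eq0 eq_sym.
Qed.

Lemma renyi_power_rescale (lambda x0 s : R) rho : 0 < s -> is_density rho ->
  renyi_exists lambda rho ->
  renyi_power lambda (rescale x0 s rho) = s ^+ 2 * renyi_power lambda rho.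
Proof.
move=> s0 drho erho; rewrite /renyi_power renyi_entropy_rescale// mulrDr expRD.
by rewrite expRM_natl lnK ?posrE.
Qed.

End complexity.

Local Close Scope classical_set_scope.

Theorem proposition1 (R : realType) (p beta lambda : R) (rho : R -> R)
    (x0 sigma : R) (p_gt1 : 1 < p) (beta_gt0 : 0 < beta)
    (lambda_gt0 : 0 < lambda) (rho_density : is_density rho)
    (rho_exists : FR_complexity_exists p beta lambda rho)
    (sigma_gt0 : 0 < sigma) :
  let rhot := fun x : R => sigma^-1 * rho ((x - x0) / sigma) in
  [/\ is_density rhot, FR_complexity_exists p beta lambda rhot &
      FR_complexity p beta lambda rhot = FR_complexity p beta lambda rho].
Proof.
move=> rhot; have [mrho _ _] := rho_density; have [frho nrho] := rho_exists.
split; first exact: is_density_rescale.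
  split; first exact: fisher_exists_rescale.
  exact: renyi_exists_rescale.
rewrite /FR_complexity renyi_power_rescale// fisher_rescale//; last 2 first.
- by rewrite gt_eqF// (lt_trans ltr01).
- by rewrite gt_eqF.
by rewrite mulrACA -exprMn mulVf ?gt_eqF// expr1n mul1r.
Qed.
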